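(* (Shirali–Ford Theorem) Let $A$ be a Banach $*$-algebra. Then $A$ is Hermitian if and only if $a^*a \geq 0$ for all $a \in A$.
   Context: All algebras are complex and associative, not necessarily unital or commutative. A $*$-algebra is an algebra with a conjugate-linear map $a\mapsto a^*$ satisfying $(a^* )^*=a$, $(ab)^*=b^*a^*$. A Banach $*$-algebra is a $*$-algebra with a complete submultiplicative norm; no relation between norm and involution is assumed (the involution may be discontinuous). An element $a$ is Hermitian if $a=a^*$. A unit is required to be non-zero. The unitisation $\tilde A$ of $A$ is $A$ itself if $A$ has a unit, and otherwise $\tilde A=\mathbb{C}e\oplus A$ with adjoined unit $e$. The spectrum of $a\in A$ is $\mathrm{sp}(a)=\{\lambda\in\mathbb{C}: \lambda e-a \text{ is not invertible in } \tilde A\}$. The $*$-algebra $A$ is called Hermitian if every Hermitian element of $A$ has real spectrum. For $a\in A$, $a\geq 0$ means that $a=a^*$ and $\mathrm{sp}(a)\subset[0,\infty[$. *)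

(* Defs.v *)
From HB Require Import structures.
From mathcomp Require Import all_boot all_order all_algebra.
From mathcomp Require Import complex.
From mathcomp Require Import boolp classical_sets reals topology normedtype.

Set Implicit Arguments.
Unset Strict Implicit.
Unset Printing Implicit Defensive.

Import Order.TTheory GRing.Theory Num.Theory.
Import numFieldNormedType.Exports.

Local Open Scope classical_set_scope.
Local Open Scope ring_scope.

Reserved Notation "x ** y" (at level 40, left associativity).

(* The library's algebras ([algType]) are unital; these need not be. *)
HB.mixin Record Lmodule_isNonUnitalAlg (K : comNzRingType) A
    of GRing.Lmodule K A := {
  amul : A -> A -> A;
  amulA : forall x y z : A, amul x (amul y z) = amul (amul x y) z;
  amulDl : forall x y z : A, amul (x + y) z = amul x z + amul y z;
  amulDr : forall x y z : A, amul x (y + z) = amul x y + amul x z;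
  amulZl : forall (k : K) (x y : A), amul (k *: x) y = k *: amul x y;
  amulZr : forall (k : K) (x y : A), amul x (k *: y) = k *: amul x y
}.

#[short(type="nonUnitalAlgType")]
HB.structure Definition NonUnitalAlg (K : comNzRingType) :=
  {A of GRing.Lmodule K A & Lmodule_isNonUnitalAlg K A}.

Notation "x ** y" := (amul x y) : ring_scope.

HB.mixin Record NonUnitalAlg_isStarAlg (C : numClosedFieldType) A
    of NonUnitalAlg C A := {
  star : A -> A;
  starD : forall x y : A, star (x + y) = star x + star y;
  starZ : forall (k : C) (x : A), star (k *: x) = k^* *: star x;
  starK : forall x : A, star (star x) = x;
  starM : forall x y : A, star (x ** y) = star y ** star x
}.

#[short(type="starAlgType")]
HB.structure Definition StarAlg (C : numClosedFieldType) :=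
  {A of NonUnitalAlg C A & NonUnitalAlg_isStarAlg C A}.

(* The norm [`|x|] takes its values in the nonnegative (hence real) part
   of [C].  No axiom relates it to [star]. *)
HB.mixin Record hasSubmultiplicativeNorm (C : numClosedFieldType) A
    of NonUnitalAlg C A & NormedModule C A := {
  norm_amul_le : forall x y : A, `|x ** y| <= `|x| * `|y|
}.

#[short(type="banachStarAlgType")]
HB.structure Definition BanachStarAlg (C : numClosedFieldType) :=
  {A of StarAlg C A & CompleteNormedModule C A
      & hasSubmultiplicativeNorm C A}.

Definition is_unity (K : comNzRingType) (A : nonUnitalAlgType K) (e : A) :=
  e <> 0 /\ forall a : A, e ** a = a /\ a ** e = a.

(* The vector space [K (+) A]; [(k, a)] stands for [k e + a]. *)
Definition adjoin_unity (K : comNzRingType) (A : nonUnitalAlgType K) : Type :=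
  (K^o * A)%type.

Section AdjoinUnity.
Variables (K : comNzRingType) (A : nonUnitalAlgType K).
Local Notation A1 := (adjoin_unity A).

HB.instance Definition _ := GRing.Lmodule.on A1.

Definition adjoin_mul (x y : A1) : A1 :=
  ((x.1 : K) * y.1, (x.1 : K) *: y.2 + (y.1 : K) *: x.2 + x.2 ** y.2).

Let adjoin_mulA x y z :
  adjoin_mul x (adjoin_mul y z) = adjoin_mul (adjoin_mul x y) z.
Proof.
case: x y z => [k a] [l b] [m c]; congr pair => /=; first exact: mulrA.
rewrite !scalerDr !amulDl !amulDr !amulZl !amulZr !scalerA amulA.
by rewrite [m * k]mulrC [m * l]mulrC !addrA [RHS](ACl (1*2*5*3*6*4*7)).
Qed.

Let adjoin_mulDl x y z :
  adjoin_mul (x + y) z = adjoin_mul x z + adjoin_mul y z.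
Proof.
case: x y z => [k a] [l b] [m c]; congr pair => /=; first exact: mulrDl.
rewrite scalerDl scalerDr amulDl.
by rewrite [X in X + _]addrACA [LHS]addrACA.
Qed.

Let adjoin_mulDr x y z :
  adjoin_mul x (y + z) = adjoin_mul x y + adjoin_mul x z.
Proof.
case: x y z => [k a] [l b] [m c]; congr pair => /=; first exact: mulrDr.
rewrite scalerDl scalerDr amulDr.
by rewrite [X in X + _]addrACA [LHS]addrACA.
Qed.

Let adjoin_mulZl (k : K) x y :
  adjoin_mul (k *: x) y = k *: adjoin_mul x y.
Proof.
case: x y => [l b] [m c]; congr pair => /=; first by rewrite -mulrA.
by rewrite !scalerDr !scalerA amulZl [m * k]mulrC.
Qed.

Let adjoin_mulZr (k : K) x y :
  adjoin_mul x (k *: y) = k *: adjoin_mul x y.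
Proof.
case: x y => [l b] [m c]; congr pair => /=; first exact: mulrCA.
by rewrite !scalerDr !scalerA amulZr [l * k]mulrC.
Qed.

HB.instance Definition _ := Lmodule_isNonUnitalAlg.Build K A1
  adjoin_mulA adjoin_mulDl adjoin_mulDr adjoin_mulZl adjoin_mulZr.

Lemma adjoin_unityP : is_unity ((1, 0) : A1).
Proof.
have amul0l (b : A) : 0 ** b = 0.
  by rewrite -[X in X ** _](scale0r (0 : A)) amulZl scale0r.
have amul0r (b : A) : b ** 0 = 0.
  by rewrite -[X in _ ** X](scale0r (0 : A)) amulZr scale0r.
split=> [[] /eqP|[k a]]; first by rewrite oner_eq0.
split; congr pair => /=.
- exact: mul1r.
- by rewrite scale1r scaler0 amul0l !addr0.
- exact: mulr1.
- by rewrite scale1r scaler0 amul0r add0r addr0.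
Qed.

End AdjoinUnity.

Record unital_over (K : comNzRingType) (A : nonUnitalAlgType K) := UnitalOver {
  uo_alg :> nonUnitalAlgType K;
  uo_unity : uo_alg;
  uo_unityP : is_unity uo_unity;
  uo_in : A -> uo_alg
}.

Definition unitisation (K : comNzRingType) (A : nonUnitalAlgType K) :
    unital_over A :=
  match pselect (exists e : A, is_unity e) with
  | left h => UnitalOver (projT2 (cid h)) id
  | right _ => UnitalOver (adjoin_unityP A) (fun a => (0, a))
  end.

Definition invertible (K : comNzRingType) (A : nonUnitalAlgType K)
    (B : unital_over A) (x : B) :=
  exists y : B, x ** y = uo_unity B /\ y ** x = uo_unity B.

Definition sp (K : comNzRingType) (A : nonUnitalAlgType K) (a : A) : set K :=
  [set k | ~ invertible (k *: uo_unity (unitisation A)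
                         - uo_in (unitisation A) a)].

Definition hermitian_elt (C : numClosedFieldType) (A : starAlgType C) (a : A) :=
  a = star a.

Definition hermitian_alg (C : numClosedFieldType) (A : starAlgType C) :=
  forall a : A, hermitian_elt a -> sp a `<=` [set z | z \is Num.real].

(* In [C], [0 <= z] means that [z] is real and nonnegative. *)
Definition star_nonneg (C : numClosedFieldType) (A : starAlgType C) (a : A) :=
  hermitian_elt a /\ sp a `<=` [set z | 0 <= z].

(* Main.v *)
Require Import Defs.
From HB Require Import structures.
From mathcomp Require Import all_boot all_order all_algebra.
From mathcomp Require Import complex.
From mathcomp Require Import boolp classical_sets reals topology normedtype.
From mathcomp Require Import ring lra.

Set Implicit Arguments.
Unset Strict Implicit.
Unset Printing Implicit Defensive.

Import Order.TTheory GRing.Theory Num.Theory.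
Import numFieldNormedType.Exports.

Local Open Scope ring_scope.

(** From right to left: if [h] is Hermitian and [z] is in its spectrum, then
    [z ^+ 2] is in the spectrum of [h^* h = h ^+ 2], so that [0 <= z ^+ 2] and
    [z] is real ([sp_sqr]).

    From left to right the argument follows Ptak.  Everything takes place in a
    unital Banach star-algebra, the unitisation.  Write [r] for the spectral
    radius; only the property [r x < 1] is ever needed, and it is available in
    two forms ([rad_lt1P]): all [1 - z x] with [|z| <= 1] are invertible, or
    some [x ^+ (2 ^ n)] is small.  Passing from the first form to the second
    uses no contour integrals: the resolvent of [x ^+ 2] is an average of
    resolvents of [x], which gives Lipschitz bounds uniform in [n].

    A Hermitian [h] with [r h < 1] has a Hermitian square root of [1 - h]
    ([sqrt_1sub], Ford's lemma; the involution may be discontinuous).  Since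
    [1 + i k] is invertible for Hermitian [k], the factorisation
    [(1 + a^* ) (1 - a) = 1 - a^* a + (a^* - a)] then shows that [r (a^* a) < 1]
    implies [r a < 1] ([rad_lt1_adj_mul]).  Consequently [r (h k) < 1] for
    Hermitian [h] and [k] with [r h, r k < 1] ([rad_lt1_hermM]), and sums of
    nonnegative elements are nonnegative ([sposD]).  As [b^* b + b b^*] is a sum
    of Hermitian squares, an upper bound [s >= 0] for the spectrum of [b^* b]
    forces the lower bound [- s] ([unit_addr_adj_mul]).

    Finally let [- t < 0] be in the spectrum of [h = a^* a], with [r h < 1].  For
    [b = sqrt 2 a (1 + h)^-1] the spectrum of [b^* b] is the image of that of
    [h] under [x |-> 2 x / (1 + x) ^ 2], whose values are at most [1 / 2];
    hence it lies in [[- 1 / 2, 1 / 2]].  But it contains [- 2 t / (1 - t) ^ 2],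
    which is at most [- 2 t], and iteration leads to a contradiction
    ([unit_add_adj_mul_rad_lt1]). *)

(** * The complex modulus *)

(** The modulus as a real number: [`|z|] itself lies in [R[i]], whose order is
    only partial. *)
Definition cabs (R : realType) (z : R[i]) : R := complex.Re `|z|.

Section ComplexModulus.
Variable R : realType.
Implicit Types (w z : R[i]) (s : R).

Lemma cabsE z : `|z| = (cabs z)%:C%C.
Proof. by rewrite /cabs RRe_real // normr_real. Qed.

Lemma cabs_ge0 z : 0 <= cabs z.
Proof. by rewrite -ler0c -cabsE. Qed.

Lemma cabs0 : cabs (0 : R[i]) = 0.
Proof. by rewrite /cabs normr0. Qed.

Lemma cabs1 : cabs (1 : R[i]) = 1.
Proof. by rewrite /cabs normr1. Qed.

Lemma cabsN z : cabs (- z) = cabs z.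
Proof. by rewrite /cabs normrN. Qed.

Lemma cabsM w z : cabs (w * z) = cabs w * cabs z.
Proof. by apply: complexI; rewrite rmorphM /= -!cabsE normrM. Qed.

Lemma cabsV z : cabs z^-1 = (cabs z)^-1.
Proof. by apply: complexI; rewrite fmorphV -!cabsE normfV. Qed.

Lemma cabsX z n : cabs (z ^+ n) = cabs z ^+ n.
Proof. by elim: n => [|n IH]; rewrite ?expr0 ?cabs1 // !exprS cabsM IH. Qed.

Lemma cabsD w z : cabs (w + z) <= cabs w + cabs z.
Proof. by rewrite -lecR rmorphD /= -!cabsE ler_normD. Qed.

Lemma cabsB w z : cabs (w - z) = cabs (z - w).
Proof. by rewrite -cabsN opprB. Qed.

Lemma cabs_conj z : cabs z^* = cabs z.
Proof. by rewrite /cabs norm_conjC. Qed.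

Lemma cabs_eq0 z : (cabs z == 0) = (z == 0).
Proof. by rewrite -[RHS]normr_eq0 cabsE -(inj_eq (@complexI _)). Qed.

Lemma cabs_gt0 z : (0 < cabs z) = (z != 0).
Proof. by rewrite lt_def cabs_eq0 cabs_ge0 andbT. Qed.

Lemma cabs_real s : cabs s%:C%C = `|s|.
Proof. by rewrite /cabs normc_def /= expr0n addr0 sqrtr_sqr. Qed.

Lemma cabs_nat n : cabs (n%:R : R[i]) = n%:R.
Proof. by rewrite -(rmorph_nat (real_complex R)) cabs_real ger0_norm. Qed.

Lemma real_complex_neq0 s : 0 < s -> s%:C%C != 0 :> R[i].
Proof. by move=> s0; rewrite -cabs_gt0 cabs_real normr_gt0 gt_eqF. Qed.

Lemma cabs_ReIm z : cabs z ^+ 2 = complex.Re z ^+ 2 + complex.Im z ^+ 2.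
Proof. by apply: complexI; rewrite rmorphXn /= -cabsE -add_Re2_Im2. Qed.

(** Locally bounded functions on a compact set are bounded; the disc is
    contained in the compact square [[-1, 1] ^ 2]. *)
Lemma disc_bounded (f : R[i] -> R) :
    (forall z0, exists d M, 0 < d /\ forall z, cabs (z - z0) <= d -> f z <= M) ->
  exists M, forall z, cabs z <= 1 -> f z <= M.
Proof.
move=> loc; pose K : set (R * R) := (`[-1, 1] `*` `[-1, 1])%classic.
have cK : compact K by apply: compact_setX; exact: segment_compact.
have cov := (compact_near_coveringP K).1 cK R (pinfty_nbhs R)
  (fun M p => f (p.1 +i* p.2)%C <= M) _.
have [p _|M [_ fM]] := cov _.
  have [d [M [d0 fd]]] := loc (p.1 +i* p.2)%C.
  near=> q M'; rewrite (le_trans (fd _ _)) //=; last first.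
    by near: M'; apply: nbhs_pinfty_ge; exact: num_real.
  have [q1 q2] : `|p.1 - q.1| < d / 2 /\ `|p.2 - q.2| < d / 2.
    near: q; have : nbhs p (ball p (d / 2)).
      by apply: nbhsx_ballx; rewrite divr_gt0.
    by apply: filterS => q [].
  rewrite -(ler_pXn2r (_ : 0 < 2)%N) ?nnegrE ?cabs_ge0 ?ltW //.
  rewrite cabs_ReIm /= -(normrN (p.1 - q.1)) in q1 *.
  rewrite -(normrN (p.2 - q.2)) in q2; move: q1 q2; rewrite !opprB.
  rewrite -(real_normK (num_real (q.1 - p.1))) -(real_normK (num_real (q.2 - p.2))).
  move: (normr_ge0 (q.1 - p.1)) (normr_ge0 (q.2 - p.2)).
  move: `|q.1 - p.1| `|q.2 - p.2| => a b a0 b0 ad bd; nra.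
(* [fM] holds for numbers strictly above [M]. *)
exists (M + 1) => z z1; have := fM (M + 1); rewrite ltrDl ltr01 => /(_ isT).
move/(_ (complex.Re z, complex.Im z)) => /=.
have -> : (complex.Re z +i* complex.Im z)%C = z by case: z {z1}.
have := cabs_ReIm z; have : cabs z ^+ 2 <= 1 by rewrite expr_le1 ?cabs_ge0.
move: (complex.Re z) (complex.Im z) => a b h1 h2.
by apply; rewrite /K /= !in_itv /=; split; apply/andP; split; nra.
Unshelve. all: by end_near.
Qed.

End ComplexModulus.

(** * Invertible elements *)

Section UnitRing.
Variable U : unitRingType.
Implicit Types x y z : U.

(** If [v] inverts [1 - x y], then [1 + y v x] inverts [1 - y x]. *)
Lemma unit_1subC x y : 1 - x * y \is a GRing.unit -> 1 - y * x \is a GRing.unit.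
Proof.
case/unitrP=> v [vl vr]; apply/unitrP; exists (1 + y * v * x).
have e1 : v * (x * y) = v - 1 by rewrite -[in RHS]vl mulrBr mulr1 subKr.
have e2 : x * y * v = v - 1 by rewrite -[in RHS]vr mulrBl mul1r subKr.
split.
- rewrite mulrDl mul1r mulrBr mulr1.
  have -> : y * v * x * (y * x) = y * (v * (x * y)) * x by rewrite !mulrA.
  by rewrite e1 mulrBr mulr1 mulrBl subKr subrK.
- rewrite mulrDr mulr1 mulrBl mul1r.
  have -> : y * x * (y * v * x) = y * (x * y * v) * x by rewrite !mulrA.
  by rewrite e2 mulrBr mulr1 mulrBl subKr subrK.
Qed.

Lemma unit_left_right x y z :
  y * x \is a GRing.unit -> x * z \is a GRing.unit -> x \is a GRing.unit.
Proof.
case/unitrP=> u [uyx _] /unitrP[v [_ xzv]]; apply/unitrP.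
have e : u * y = z * v.
  by rewrite -[LHS]mulr1 -xzv !mulrA -[u * y * x]mulrA uyx mul1r.
by exists (u * y); split; [rewrite -mulrA | rewrite e mulrA].
Qed.

End UnitRing.

Lemma comm_scaler (K : comNzRingType) (U : algType K) (z : K) (x y : U) :
  GRing.comm x y -> GRing.comm x (z *: y).
Proof. by move=> xy; rewrite /GRing.comm -scalerAr -scalerAl xy. Qed.

(** * Banach algebras and the spectral radius *)

(** A complete submultiplicative norm, with completeness in the form
    in which iterations use it: sequences with geometrically small
    increments converge.  Real values allow linear arithmetic. *)
Record banach_norm (R : realType) (U : unitAlgType R[i]) := BanachNorm {
  nrm :> U -> R;
  nrmD : forall x y, nrm (x + y) <= nrm x + nrm y;
  nrmM : forall x y, nrm (x * y) <= nrm x * nrm y;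
  nrmZ : forall k x, nrm (k *: x) = cabs k * nrm x;
  nrm_eq0 : forall x, nrm x = 0 -> x = 0;
  nrm_complete : forall (u : nat -> U) (K : R),
    (forall n, nrm (u n.+1 - u n) <= K * 2^-1 ^+ n) ->
    exists l, forall e, 0 < e ->
      exists M, forall n, (M <= n)%N -> nrm (u n - l) <= e
}.

(** The spectrum of [x] lies in the open unit disc. *)
Definition rad_lt1 (R : realType) (U : unitAlgType R[i]) (x : U) :=
  forall z : R[i], cabs z <= 1 -> 1 - z *: x \is a GRing.unit.

Section BanachAlgebra.
Variables (R : realType) (U : unitAlgType R[i]) (N : banach_norm U).
Implicit Types (x y c d : U) (z w : R[i]) (s t r : R).

Lemma nrm0 : N 0 = 0.
Proof. by rewrite -(scale0r (0 : U)) nrmZ cabs0 mul0r. Qed.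

Lemma nrmN x : N (- x) = N x.
Proof. by rewrite -scaleN1r nrmZ cabsN cabs1 mul1r. Qed.

Lemma nrmB x y : N (x - y) <= N x + N y.
Proof. by rewrite (le_trans (nrmD _ _ _)) // nrmN. Qed.

Lemma nrm_distC x y : N (x - y) = N (y - x).
Proof. by rewrite -nrmN opprB. Qed.

Lemma nrm_ge0 x : 0 <= N x.
Proof. by have := nrmB x x; rewrite subrr nrm0 => h; lra. Qed.

Lemma nrm_tri y x c : N (x - c) <= N (x - y) + N (y - c).
Proof. by rewrite -(subrKA y) nrmD. Qed.

Lemma nrm_small_eq0 x : (forall e, 0 < e -> N x <= e) -> x = 0.
Proof.
move=> small; apply: (@nrm_eq0 _ _ N); apply/eqP; rewrite eq_le nrm_ge0 andbT.
by apply/ler_addgt0Pl => e e0; rewrite addr0; exact: small.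
Qed.

(** The last clause makes up for continuity arguments: the fixed point is a
    limit of iterates of [f] at [0], and the commutant of [d] is closed. *)
Lemma contraction_fixpoint (f : U -> U) r : 0 <= r ->
    (forall x, N x <= r -> N (f x) <= r) ->
    (forall x y, N x <= r -> N y <= r -> N (f x - f y) <= N (x - y) / 2) ->
  exists l, [/\ N l <= r, f l = l &
    forall d, (forall x, GRing.comm d x -> GRing.comm d (f x)) -> GRing.comm d l].
Proof.
move=> r0 fr fc; pose u n := iter n f 0.
have ur n : N (u n) <= r by elim: n => [|n IH] /=; [rewrite nrm0 | exact: fr].
have step n : N (u n.+1 - u n) <= (2 * r) * 2^-1 ^+ n.
  elim: n => [|n IH]; first by rewrite expr0 mulr1 subr0; have := ur 1%N; lra.
  apply: le_trans (fc _ _ (ur n.+1) (ur n)) _.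
  by rewrite exprSr mulrA ler_pM2r ?invr_gt0.
have [l lim] := nrm_complete step.
have lr : N l <= r.
  apply/ler_addgt0Pr => e e0; have [M /(_ M (leqnn M)) le_e] := lim e e0.
  have := nrm_tri (u M) l 0; rewrite !subr0 nrm_distC.
  by have := ur M; lra.
exists l; split=> //.
- apply/eqP; rewrite -subr_eq0; apply/eqP/nrm_small_eq0 => e e0.
  have [M limM] := lim (e / 2) (divr_gt0 e0 (ltr0n _ 2)).
  have h1 := limM M (leqnn M); have h2 := limM M.+1 (leqnSn M).
  have := nrm_tri (u M.+1) (f l) l; have := fc _ _ lr (ur M).
  by rewrite nrm_distC in h1; rewrite -[f (u M)]/(u M.+1) => h3 h4; lra.
- move=> d df; have du n : GRing.comm d (u n).
    by elim: n => [|n IH]; [exact: commr0 | exact: df].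
  apply/eqP; rewrite -subr_eq0; apply/eqP/nrm_small_eq0 => e e0.
  have k0 : 0 < 2 * (N d + 1) by have := nrm_ge0 d; lra.
  have [M /(_ M (leqnn M)) limM] := lim (e / (2 * (N d + 1))) (divr_gt0 e0 k0).
  have -> : d * l - l * d = (u M - l) * d - d * (u M - l).
    by rewrite mulrBl mulrBr (du M) opprB [RHS]addrC addrA subrK.
  apply: le_trans (nrmB _ _) _.
  have /= h1 := nrmM N (u M - l) d; have /= h2 := nrmM N d (u M - l).
  rewrite ler_pdivlMr // in limM; have := nrm_ge0 d; have := nrm_ge0 (u M - l).
  by move=> p q; nra.
Qed.

(** The inverse is the fixed point of [x |-> 1 + c x]; it commutes with [c],
    hence is two-sided. *)
Lemma neumann c : N c <= 1 / 2 -> 1 - c \is a GRing.unit.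
Proof.
move=> c2.
have [||x y _ _|l [_ fl cl]] := @contraction_fixpoint (fun x => 1 + c * x) (2 * N 1).
- by have := nrm_ge0 1; lra.
- move=> x xr; have := nrmD N 1 (c * x); have := nrmM N c x.
  by have := nrm_ge0 x; have := nrm_ge0 c; have := nrm_ge0 1 => p1 p2 p3 h1 h2; nra.
- have -> : 1 + c * x - (1 + c * y) = c * (x - y).
    by rewrite mulrBr opprD addrACA subrr add0r.
  by have := nrmM N c (x - y); have := nrm_ge0 (x - y); nra.
have e : (1 - c) * l = 1 by rewrite mulrBl mul1r -{1}fl addrK.
apply/unitrP; exists l; split=> //.
have cc : GRing.comm c l.
  by apply: cl => x cx; apply: commrD; [exact: commr1 | apply: commrM].
by rewrite mulrBr mulr1 -cc -[in LHS](mul1r l) mulrA mulr1 -mulrBl.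
Qed.

(** [g = (1 - c)^-1 y] satisfies [g = y + c g].  Multiplying by [y] keeps the
    norm of [1], which may exceed [1], out of the estimate. *)
Lemma nrm_neumann_le c y : N c <= 1 / 2 -> N ((1 - c)^-1 * y) <= 2 * N y.
Proof.
move=> c2; have uc := neumann c2; set g := _ * y.
have eg : g = y + c * g.
  have : (1 - c) * g = y by rewrite mulrA divrr ?mul1r.
  by rewrite mulrBl mul1r => <-; rewrite subrK.
have := nrmD N y (c * g); rewrite -eg => h1; have := nrmM N c g => h2.
by have := nrm_ge0 g => h3; nra.
Qed.

(** Near [z0] the factor [1 - (z - z0) (1 - z0 x)^-1 x] of [1 - z x] is close
    to [1], so the resolvent is locally bounded. *)
Lemma resolvent_bounded x : rad_lt1 x ->
  exists M, forall z, cabs z <= 1 -> N (1 - z *: x)^-1 <= M.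
Proof.
move=> rx; pose f z := if cabs z <= 1 then N (1 - z *: x)^-1 else 0.
have [z0|M fM] := @disc_bounded R f; last first.
  by exists M => z z1; have := fM z z1; rewrite /f z1.
have [z01|z01] := leP (cabs z0) 1; last first.
  (* a ball around [z0] that misses the disc *)
  exists ((cabs z0 - 1) / 2), 0; split=> [|z dz]; first by rewrite divr_gt0 // subr_gt0.
  rewrite /f ifF //; apply/negbTE; rewrite -ltNge.
  by have := cabsD (z0 - z) z; rewrite subrK cabsB => h; lra.
have ux := rx _ z01; set g0 := (1 - z0 *: x)^-1.
have k0 : 0 < 2 * (N (g0 * x) + 1) by have := nrm_ge0 (g0 * x); lra.
exists (2 * (N (g0 * x) + 1))^-1, (2 * N g0); split=> [|z dz].
  by rewrite invr_gt0.
rewrite /f; case: ifP => z1; last by have := nrm_ge0 g0; lra.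
have e1 : (1 - z0 *: x) * (1 - (z - z0) *: (g0 * x)) = 1 - z *: x.
  rewrite mulrBr mulr1 -scalerAr mulrA divrr ?mul1r // scalerBl opprB addrA.
  by rewrite subrK.
have small : N ((z - z0) *: (g0 * x)) <= 1 / 2.
  rewrite nrmZ; have := nrm_ge0 (g0 * x); have := cabs_ge0 (z - z0).
  move: dz; rewrite -[_^-1]mul1r ler_pdivlMr // => a b c; nra.
by rewrite -e1 (invrM ux (neumann small)) nrm_neumann_le.
Qed.

Lemma rad_lt1_sqr x : rad_lt1 x -> rad_lt1 (x ^+ 2).
Proof.
move=> rx z z1; have s1 : cabs (sqrtC z) <= 1.
  by rewrite -(@expr_le1 _ 2) ?cabs_ge0 // -cabsX sqrtCK.
have -> : 1 - z *: x ^+ 2 = (1 - sqrtC z *: x) * (1 - (- sqrtC z) *: x).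
  rewrite scaleNr opprK mulrBl mul1r mulrDr mulr1 -scalerAl -scalerAr scalerA.
  by rewrite -!expr2 sqrtCK opprD addrA addrK.
rewrite unitrM_comm ?rx ?cabsN //; apply: commrB; first exact: commr1.
apply: comm_scaler; apply/commr_sym/commrB; first exact: commr1.
exact: comm_scaler.
Qed.

Lemma rad_lt1_pow2 x n : rad_lt1 x -> rad_lt1 (x ^+ (2 ^ n)).
Proof. by move=> rx; elim: n => // n IH; rewrite expnSr exprM; exact: rad_lt1_sqr. Qed.

Lemma resolvent_sqr x z : rad_lt1 x -> cabs z <= 1 ->
  (1 - z ^+ 2 *: x ^+ 2)^-1 = 2^-1 *: ((1 - z *: x)^-1 + (1 - (- z) *: x)^-1).
Proof.
move=> rx z1; have ua := rx _ z1; have ub : 1 - (- z) *: x \is a GRing.unit.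
  by rewrite rx ?cabsN.
set a := 1 - z *: x in ua *; set b := 1 - _ *: x in ub *.
have eab : a + b = 2 *: 1.
  rewrite /a /b scaleNr opprK addrACA addNr addr0.
  by rewrite scaler_nat.
have -> : 1 - z ^+ 2 *: x ^+ 2 = b * a.
  rewrite /a /b scaleNr opprK mulrDl mul1r mulrBr mulr1 -exprZn -expr2.
  by rewrite addrA subrK.
have -> : a^-1 + b^-1 = a^-1 * (a + b) * b^-1.
  by rewrite mulrDr mulVr // mulrDl mul1r mulrK // addrC.
rewrite eab -scalerAr mulr1 -scalerAl scalerA mulVf ?scale1r ?invrM //.
by rewrite pnatr_eq0.
Qed.

Lemma pow2_root_N1 n : exists2 z : R[i], cabs z = 1 & z ^+ (2 ^ n) = -1.
Proof.
elim: n => [|n [z z1 zn]]; first by exists (-1); rewrite ?cabsN ?cabs1.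
exists (sqrtC z); last by rewrite expnS exprM sqrtCK.
by apply/eqP; rewrite -(@pexpr_eq1 _ _ 2) ?cabs_ge0 // -cabsX sqrtCK z1.
Qed.

(** By [resolvent_sqr], each squaring replaces the resolvent by an average of
    its values at two points, the second obtained from the first by a rotation
    ([w] with [w ^+ (2 ^ n) = -1] below).  Rotations preserve rays, so the
    Lipschitz constant on rays is inherited. *)
Lemma resolvent_pow2_lipschitz x : rad_lt1 x -> exists L, forall n z s t,
    cabs z <= 1 -> 0 <= s <= 1 -> 0 <= t <= 1 ->
  N ((1 - (s%:C%C * z) ^+ (2 ^ n) *: x ^+ (2 ^ n))^-1 -
     (1 - (t%:C%C * z) ^+ (2 ^ n) *: x ^+ (2 ^ n))^-1) <= L * `|s - t|.
Proof.
move=> rx; have [M Mb] := resolvent_bounded rx; exists (M * N x * M).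
have sc s z : cabs z <= 1 -> 0 <= s <= 1 -> cabs (s%:C%C * z) <= 1.
  move=> z1 /andP[s0 s1]; rewrite cabsM cabs_real ger0_norm //.
  by have := cabs_ge0 z; nra.
elim=> [|n IH] z s t z1 s1 t1.
- rewrite expn0 !expr1; set a := 1 - _ *: x; set b := 1 - (t%:C%C * z) *: x.
  have [ua ub] : a \is a GRing.unit /\ b \is a GRing.unit by split; apply: rx; exact: sc.
  have -> : a^-1 - b^-1 = a^-1 * (((s - t)%:C%C * z) *: x) * b^-1.
    have -> : ((s - t)%:C%C * z) *: x = b - a.
      by rewrite /a /b opprB [RHS]addrC subrKA -scalerBl rmorphB mulrBl.
    by rewrite mulrBr mulVr // mulrBl mul1r mulrK.
  apply: le_trans (nrmM _ _ _) _; apply: le_trans.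
    by apply: ler_wpM2r (nrmM _ _ _); exact: nrm_ge0.
  rewrite nrmZ cabsM cabs_real.
  have := Mb _ (sc s z z1 s1); have := Mb _ (sc t z z1 t1); rewrite -/a -/b.
  move=> hb ha; have Na0 := nrm_ge0 a^-1; have Nb0 := nrm_ge0 b^-1.
  have Nx0 := nrm_ge0 x; have c0 := cabs_ge0 z; have d0 := normr_ge0 (s - t).
  have hle : N a^-1 * N x * N b^-1 <= M * N x * M.
    by rewrite ler_pM ?mulr_ge0 // ler_wpM2r.
  have h0 : 0 <= N a^-1 * N x * N b^-1 by rewrite !mulr_ge0.
  have -> : N a^-1 * (`|s - t| * cabs z * N x) * N b^-1 =
    cabs z * (N a^-1 * N x * N b^-1) * `|s - t| by ring.
  rewrite ler_wpM2r // (le_trans _ hle) //.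
  by rewrite -[leRHS]mul1r ler_wpM2r.
- have [w w1 wn] := pow2_root_N1 n.
  have rn := rad_lt1_pow2 n rx.
  have pc v : cabs v <= 1 -> cabs (v ^+ (2 ^ n)) <= 1.
    by move=> v1; rewrite cabsX exprn_ile1 ?cabs_ge0.
  have e v : 0 <= v <= 1 ->
      (1 - (v%:C%C * z) ^+ (2 ^ n.+1) *: x ^+ (2 ^ n.+1))^-1 =
      2^-1 *: ((1 - (v%:C%C * z) ^+ (2 ^ n) *: x ^+ (2 ^ n))^-1 +
               (1 - (v%:C%C * (z * w)) ^+ (2 ^ n) *: x ^+ (2 ^ n))^-1).
    move=> v1; rewrite expnSr !exprM resolvent_sqr //; last by apply/pc/sc.
    by rewrite [v%:C%C * (z * w)]mulrA [(_ * w) ^+ _]exprMn wn mulrN1.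
  rewrite !e // -scalerBr nrmZ opprD addrACA cabsV cabs_nat.
  have zw : cabs (z * w) <= 1 by rewrite cabsM w1 mulr1.
  have h1 := IH z s t z1 s1 t1; have h2 := IH (z * w) s t zw s1 t1.
  rewrite mulrC ler_pdivrMr // (le_trans (nrmD _ _ _)) // mulr_natr mulr2n.
  exact: lerD.
Qed.

(** In terms of the spectral radius [r], both this and [rad_lt1 x] say [r x < 1]. *)
Definition pow_small x := exists n, N (x ^+ (2 ^ n)) <= 1 / 2.

Lemma nrm_sqr_le x e : 0 <= e -> N x <= e -> N (x ^+ 2) <= e ^+ 2.
Proof.
move=> e0 xe; rewrite expr2; apply: le_trans (nrmM _ _ _) _.
by rewrite expr2 ler_pM // nrm_ge0.
Qed.

Lemma pow_small_ge x : pow_small x ->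
  exists n, forall m, (n <= m)%N -> N (x ^+ (2 ^ m)) <= 1 / 2.
Proof.
case=> n xn; exists n => m /subnK <-; elim: (m - n)%N => // k IH.
rewrite addSn expnSr exprM; apply: le_trans (@nrm_sqr_le _ (1 / 2) _ IH) _; lra.
Qed.

Lemma pow_small_sixteenth x : pow_small x -> exists n, N (x ^+ (2 ^ n)) <= 1 / 16.
Proof.
case=> n xn; exists n.+2; rewrite 2!expnSr !exprM.
have h : N ((x ^+ (2 ^ n)) ^+ 2) <= 1 / 4.
  by apply: le_trans (nrm_sqr_le _ xn) _; lra.
by apply: le_trans (nrm_sqr_le _ h) _; lra.
Qed.

Lemma pow_small_rad_lt1 x : pow_small x -> rad_lt1 x.
Proof.
case=> n xn z z1; have : 1 - (z *: x) ^+ (2 ^ n) \is a GRing.unit.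
  apply: neumann; rewrite exprZn nrmZ cabsX.
  have := nrm_ge0 (x ^+ (2 ^ n)).
  have := exprn_ile1 (2 ^ n) (cabs_ge0 z) z1; have := exprn_ge0 (2 ^ n) (cabs_ge0 z).
  by move: (cabs z ^+ _) (N _) xn => a b; nra.
elim: n {xn} => // n IH; rewrite expnSr exprM => u; apply: IH.
move: u; set y := _ ^+ (2 ^ n) => u.
have e : 1 - y ^+ 2 = (1 - y) * (1 + y).
  by rewrite mulrDr mulr1 mulrBl mul1r addrA subrK.
move: u; rewrite e unitrM_comm; first by case/andP.
apply: commrD; first exact: commr1.
by apply/commr_sym/commrB => //; exact: commr1.
Qed.

(** The key to avoiding contour integrals: [s x] is followed from [s = 0]
    to [s = 1] in steps short enough for the uniform Lipschitz bound to
    keep [(1 - (s x) ^+ (2 ^ n))^-1] close to [1]. *)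
Lemma rad_lt1_pow_small x : rad_lt1 x -> pow_small x.
Proof.
move=> rx; have [L lip] := resolvent_pow2_lipschitz rx.
(* steps of length [1 / m] change the resolvents by at most [1 / 8] *)
pose m := (Num.bound `|8 * L|).+1.
have m0 : 0 < m%:R :> R by rewrite ltr0n.
have Lm : L / m%:R <= 1 / 8.
  rewrite ler_pdivrMr //; have : 8 * L <= m%:R; last by lra.
  have := archi_boundP (normr_ge0 (8 * L)); move/ltW/(le_trans (ler_norm _)).
  by move/le_trans; apply; rewrite ler_nat.
suff walk j : (j <= m)%N -> pow_small ((j%:R / m%:R)%:C%C *: x).
  by have := walk m (leqnn m); rewrite divff ?gt_eqF // scale1r.
elim: j => [|j IH] jm.
  by exists 0%N; rewrite mul0r scale0r expr0n /= nrm0; lra.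
(* [1 / 16] gives [1 / 8] for the resolvent at [s], hence [1 / 4] at [t] and
   [1 / 2] for the power itself *)
have [n small] := pow_small_sixteenth (IH (ltnW jm)); exists n.
move: small; rewrite !exprZn; set s := j%:R / m%:R; set t := j.+1%:R / m%:R => small.
have s01 : 0 <= s <= 1.
  by rewrite /s divr_ge0 ?ler0n //= ler_pdivrMr // mul1r (ler_nat R) ltnW.
have t01 : 0 <= t <= 1.
  by rewrite /t divr_ge0 ?ler0n //= ler_pdivrMr // mul1r (ler_nat R).
have st : `|t - s| = m%:R^-1.
  by rewrite /t /s -mulrBl -natr1 addrAC subrr add0r mul1r ger0_norm ?invr_ge0 ?ltW.
have := lip n 1 t s; rewrite cabs1 st => /(_ (lexx 1) t01 s01); rewrite !mulr1.
set c := _ *: _ in small *; set b := _ *: _ => close.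
have ub : 1 - b \is a GRing.unit.
  rewrite /b; apply: (rad_lt1_pow2 n rx); rewrite cabsX exprn_ile1 ?cabs_ge0 //.
  by case/andP: t01 => t0 t1; rewrite cabs_real ger0_norm.
move: c b small close ub => c b small close ub.
have c2 : N c <= 1 / 2 by lra.
have uc := neumann c2.
have c1 : (1 - c)^-1 - 1 = (1 - c)^-1 * c.
  by rewrite -[X in _ - X](mulVr uc) -{1}[_^-1]mulr1 -mulrBr subKr.
have h1 : N ((1 - c)^-1 - 1) <= 1 / 8.
  by rewrite c1; have := nrm_neumann_le c c2; lra.
have h2 : N ((1 - b)^-1 - 1) <= 1 / 4.
  by have := nrm_tri (1 - c)^-1 (1 - b)^-1 1; lra.
set y := (1 - b)^-1 - 1 in h2.
have ey : (1 - b)^-1 = 1 - - y by rewrite opprK /y [RHS]addrC subrK.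
have -> : b = (1 - - y)^-1 * y.
  by rewrite -ey invrK /y mulrBr divrr // mulr1 subKr.
have y2 : N (- y) <= 1 / 2 by rewrite nrmN; lra.
by have := nrm_neumann_le y y2; lra.
Qed.

Lemma rad_lt1P x : rad_lt1 x <-> pow_small x.
Proof. by split; [exact: rad_lt1_pow_small | exact: pow_small_rad_lt1]. Qed.

Lemma rad_lt1M x y : GRing.comm x y -> rad_lt1 x -> rad_lt1 y -> rad_lt1 (x * y).
Proof.
move=> cxy /rad_lt1P/pow_small_ge[m hm] /rad_lt1P/pow_small_ge[n hn].
apply/rad_lt1P; exists (maxn m n); rewrite exprMn_comm //.
apply: le_trans (nrmM _ _ _) _.
have := hm _ (leq_maxl m n); have := hn _ (leq_maxr m n).
have := nrm_ge0 (x ^+ (2 ^ maxn m n)); have := nrm_ge0 (y ^+ (2 ^ maxn m n)).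
by move: (N _) (N _) => a b; nra.
Qed.

Lemma rad_lt1_small x : N x <= 1 / 2 -> rad_lt1 x.
Proof. by move=> h; apply/rad_lt1P; exists 0%N; rewrite expn0 expr1. Qed.

(** [2 - x - y = (1 - x (2 - y)^-1) (2 - y)], and [(2 - y)^-1] has
    spectral radius below [1]. *)
Lemma unit_2sub x y : GRing.comm x y -> rad_lt1 x -> rad_lt1 y ->
  2 - x - y \is a GRing.unit.
Proof.
move=> cxy rx ry.
have u2 z : cabs z <= 1 -> (2 - z)%:A - y \is a GRing.unit.
  move=> z1; have z2 : 1 <= cabs (2 - z).
    by have := cabsD (2 - z) z; rewrite subrK cabs_nat; lra.
  have z0 : 2 - z != 0 by rewrite -cabs_gt0 (lt_le_trans ltr01).
  have -> : (2 - z)%:A - y = (2 - z) *: (1 - (2 - z)^-1 *: y).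
    by rewrite scalerBr scalerA divff ?scale1r.
  rewrite scaler_unit ?unitfE //; apply: ry; rewrite cabsV invf_le1 //.
  exact: lt_le_trans z2.
have e2 : (2 : R[i])%:A = 2 :> U by rewrite scaler_nat.
have u : 2 - y \is a GRing.unit by have := u2 0; rewrite subr0 cabs0 e2; apply.
have rv : rad_lt1 (2 - y)^-1.
  move=> z /u2 uz; have -> : 1 - z *: (2 - y)^-1 = ((2 - z)%:A - y) * (2 - y)^-1.
    by rewrite scalerBl e2 [2 - _ - y]addrAC mulrBl divrr // -scalerAl mul1r.
  by rewrite unitrMl ?unitrV.
have cx : GRing.comm x (2 - y)^-1.
  by apply: commrV; apply: commrB => //; exact: commr_nat.
have := rad_lt1M cx rx rv; move/(_ 1); rewrite cabs1 scale1r => /(_ (lexx 1)) u1.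
have -> : 2 - x - y = (1 - x * (2 - y)^-1) * (2 - y).
  by rewrite mulrBl mul1r mulrVK // [RHS]addrAC.
by rewrite unitrMl.
Qed.

End BanachAlgebra.

(** * Involutions *)

Record involution (R : realType) (U : unitAlgType R[i]) := Involution {
  adj :> U -> U;
  adjD : forall x y, adj (x + y) = adj x + adj y;
  adjZ : forall k x, adj (k *: x) = k^* *: adj x;
  adjK : forall x, adj (adj x) = x;
  adjM : forall x y, adj (x * y) = adj y * adj x
}.

Section Involution.
Variables (R : realType) (U : unitAlgType R[i]) (adj : involution U).
Implicit Types (x y h : U) (z : R[i]) (s : R).

Lemma adjN x : adj (- x) = - adj x.
Proof. by rewrite -scaleN1r adjZ rmorphN1 scaleN1r. Qed.

Lemma adjB x y : adj (x - y) = adj x - adj y.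
Proof. by rewrite adjD adjN. Qed.

Lemma adj1 : adj 1 = 1.
Proof. by have := adjM adj (adj 1) 1; rewrite mulr1 adjK mulr1. Qed.

Lemma adjZr s x : adj (s%:C%C *: x) = s%:C%C *: adj x.
Proof.
rewrite adjZ; congr (_ *: _); rewrite (CrealP _) //.
by apply/complex_realP; exists s.
Qed.

Lemma unit_adj x : (adj x \is a GRing.unit) = (x \is a GRing.unit).
Proof.
have imp y : y \is a GRing.unit -> adj y \is a GRing.unit.
  by case/unitrP=> v [vy yv]; apply/unitrP; exists (adj v); rewrite -!adjM vy yv adj1.
by apply/idP/idP => [/imp|/imp //]; rewrite adjK.
Qed.

Lemma adjV x : adj x^-1 = (adj x)^-1.
Proof.
have [ux|nux] := boolP (x \is a GRing.unit); last first.
  by rewrite !invr_out // unit_adj.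
apply: (mulIr (x := adj x)); first by rewrite unit_adj.
by rewrite -adjM divrr // adj1 mulVr // unit_adj.
Qed.

Lemma adjX x n : adj (x ^+ n) = adj x ^+ n.
Proof. by elim: n => [|n IH]; rewrite ?adj1 // exprS adjM IH -exprSr. Qed.

Lemma rad_lt1_adj x : rad_lt1 x -> rad_lt1 (adj x).
Proof.
move=> rx z z1; rewrite -unit_adj adjB adj1 adjZ adjK.
by apply: rx; rewrite cabs_conj.
Qed.

End Involution.

(** * Ford's square root lemma *)

Section SquareRoot.
Variables (R : realType) (U : unitAlgType R[i]).
Variables (N : banach_norm U) (adj : involution U).
Implicit Types (c d u y h : U).

(** Square roots [1 - y] of [1 - c] are the fixed points of
    [y |-> (c + y ^+ 2) / 2], a contraction of the ball of radius [1 / 2]. *)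
Lemma sqrt_1sub_small c : N c <= 1 / 2 -> exists y,
  [/\ N y <= 1 / 2, (1 - y) ^+ 2 = 1 - c &
      forall d, GRing.comm d c -> GRing.comm d y].
Proof.
move=> c2; have half : cabs (2^-1 : R[i]) = 2^-1 by rewrite cabsV cabs_nat.
have [| x x2 | x y x2 y2 |y [y2 fy cy]] :=
  @contraction_fixpoint _ _ N (fun y => 2^-1 *: (c + y ^+ 2)) (1 / 2).
- by lra.
- rewrite nrmZ half; have := nrmD N c (x ^+ 2); have := nrm_sqr_le _ x2.
  by lra.
- rewrite /= -scalerBr nrmZ half opprD addrACA subrr add0r.
  have -> : x ^+ 2 - y ^+ 2 = x * (x - y) + (x - y) * y.
    by rewrite mulrBr mulrBl !expr2 addrA subrK.
  have := nrmD N (x * (x - y)) ((x - y) * y); have := nrmM N x (x - y).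
  have := nrmM N (x - y) y; have := nrm_ge0 N (x - y).
  by move: (N _) (N _) (N _) (N (x - y)) x2 y2 => *; nra.
exists y; split=> //.
- have : c + y ^+ 2 = 2 *: y by rewrite -fy scalerA divff ?pnatr_eq0 // scale1r fy.
  move/(congr1 (fun t => t - y ^+ 2)); rewrite addrK => ->.
  by rewrite -opprB sqrrN sqrrB1 scaler_nat opprB [RHS]addrC.
- move=> d dc; apply: cy => x dx; apply/comm_scaler/commrD => //.
  exact: commrX.
Qed.

(** The involution may be discontinuous, so that the limit [y] is not obviously
    Hermitian.  But [y^*] has the same equation, commutes with [y] and has
    spectral radius below [1], and such a solution is unique. *)
Lemma sqrt_1sub_small_herm c : adj c = c -> N c <= 1 / 2 -> exists u,
  [/\ adj u = u, u ^+ 2 = 1 - c & forall d, GRing.comm d c -> GRing.comm d u].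
Proof.
move=> hc c2; have [y [y2 ysq cy]] := sqrt_1sub_small c2.
have zsq : (1 - adj y) ^+ 2 = 1 - c.
  by rewrite -(adj1 adj) -adjB -adjX ysq adjB hc.
have yc : GRing.comm c y by apply: cy.
have zc : GRing.comm (adj y) c by rewrite /GRing.comm -{1 2}hc -!adjM yc.
have zy := cy _ zc.
have ry : rad_lt1 y by exact: (rad_lt1_small y2).
have u2 := unit_2sub N (commr_sym zy) ry (rad_lt1_adj adj ry).
have yz : y = adj y.
  apply/eqP; rewrite -subr_eq0 -(mulrI_eq0 _ (mulrI u2)); apply/eqP.
  have -> : 2 - y - adj y = (1 - y) + (1 - adj y) by rewrite [RHS]addrACA [RHS]addrA.
  have -> : y - adj y = (1 - adj y) - (1 - y) by rewrite opprB [RHS]addrC subrKA.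
  have cc : GRing.comm (1 - y) (1 - adj y).
    apply: commrB; first exact: commr1.
    by apply/commr_sym/commrB => //; exact: commr1.
  move: (1 - y) (1 - adj y) cc ysq zsq => a b cc asq bsq.
  by rewrite mulrBr !mulrDl cc -!expr2 asq bsq [X in X - _]addrC subrr.
exists (1 - y); split=> //; first by rewrite adjB adj1 -yz.
by move=> d /cy dy; apply: commrB => //; exact: commr1.
Qed.

(** [1 - h] is the product of the commuting factors
    [(1 - (j+1)/m h) (1 - j/m h)^-1 = 1 - (1 - j/m h)^-1 h/m], which are close
    to [1] for large [m] because the resolvent is bounded on the disc. *)
Lemma sqrt_1sub h : adj h = h -> rad_lt1 h -> exists u,
  [/\ adj u = u, u ^+ 2 = 1 - h & forall d, GRing.comm d h -> GRing.comm d u].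
Proof.
move=> hh rh; have [M Mb] := resolvent_bounded N rh.
have M0 : 0 <= M by apply: le_trans (Mb 0 _); rewrite ?nrm_ge0 // cabs0.
pose m := (Num.bound (2 * (M * N h))).+1.
have m0 : 0 < m%:R :> R by rewrite ltr0n.
have Mm : M * N h / m%:R <= 1 / 2.
  rewrite ler_pdivrMr //; have : 2 * (M * N h) <= m%:R; last by lra.
  have k0 : 0 <= 2 * (M * N h) by rewrite !mulr_ge0 ?nrm_ge0.
  by rewrite ltW // (lt_trans (archi_boundP k0)) // ltr_nat.
suff walk j : (j <= m)%N -> exists u, [/\ adj u = u,
    u ^+ 2 = 1 - (j%:R / m%:R)%:C%C *: h &
    forall d, GRing.comm d h -> GRing.comm d u].
  by have := walk m (leqnn m); rewrite divff ?gt_eqF // scale1r.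
elim: j => [|j IH] jm.
  exists 1; rewrite mul0r scale0r subr0 expr1n adj1; split=> // d _.
  exact: commr1.
have [u [hu usq cu]] := IH (ltnW jm).
set s := j%:R / m%:R in usq.
have s1 : cabs s%:C%C <= 1.
  rewrite cabs_real ger0_norm /s ?divr_ge0 ?ler0n // ler_pdivrMr // mul1r.
  by rewrite (ler_nat R) ltnW.
have ug := rh _ s1; set g := (1 - s%:C%C *: h)^-1 in ug.
have chg d : GRing.comm d h -> GRing.comm d g.
  move=> dh; apply/commrV/commrB; first exact: commr1.
  exact: comm_scaler.
have hg : adj g = g by rewrite /g adjV adjB adj1 adjZr hh.
pose c := (m%:R^-1)%:C%C *: (g * h).
have hc : adj c = c by rewrite /c adjZr adjM hg hh -(chg h).
have c2 : N c <= 1 / 2.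
  rewrite nrmZ cabs_real ger0_norm ?invr_ge0 ?(ltW m0) // mulrC.
  apply: (le_trans _ Mm); apply: ler_wpM2r; first by rewrite invr_ge0 ltW.
  apply: le_trans (nrmM _ _ _) _; apply: ler_wpM2r; first exact: nrm_ge0.
  exact: Mb.
have cc d : GRing.comm d h -> GRing.comm d c.
  by move=> dh; apply/comm_scaler/commrM => //; exact: chg.
have [v [hv vsq cv]] := sqrt_1sub_small_herm hc c2.
have uv : GRing.comm u v by apply/cv/cc/commr_sym/cu.
exists (u * v); split.
- by rewrite adjM hu hv uv.
- rewrite exprMn_comm // usq vsq mulrBr mulr1 /c -scalerAr mulrA divrr // mul1r.
  have -> : j.+1%:R / m%:R = s + m%:R^-1 by rewrite -[j.+1%:R]natr1 mulrDl mul1r.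
  by rewrite rmorphD scalerDl opprD addrA.
- by move=> d dh; apply: commrM; [exact: cu | apply/cv/cc].
Qed.

End SquareRoot.

(** * Hermitian algebras *)

Section Hermitian.
Variables (R : realType) (U : unitAlgType R[i]).
Variables (N : banach_norm U) (adj : involution U).
Hypothesis herm : forall (h : U) (z : R[i]), adj h = h -> z \isn't Num.real ->
  z%:A - h \is a GRing.unit.
Implicit Types (a b h k x y : U) (z : R[i]) (s t : R).

Lemma unit_1addi h : adj h = h -> 1 + 'i *: h \is a GRing.unit.
Proof.
move=> hh; have -> : 1 + 'i *: h = (- 'i) *: ('i%:A - h).
  by rewrite scalerBr scalerA mulNr -expr2 sqrCi opprK scale1r scaleNr opprK.
by rewrite scaler_unit ?herm ?nonRealCi // unitfE oppr_eq0 neq0Ci.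
Qed.

Lemma unit_1subi h : adj h = h -> 1 - 'i *: h \is a GRing.unit.
Proof. by move=> hh; rewrite -scalerN unit_1addi // adjN hh. Qed.

(** With [u ^+ 2 = 1 - h] this element is [u (1 + u^-1 k u^-1) u], and
    [u^-1 k u^-1] is [i] times a Hermitian element. *)
Lemma unit_1sub_skew h k : adj h = h -> rad_lt1 h -> adj k = - k ->
  1 - h + k \is a GRing.unit.
Proof.
move=> hh rh sk; have [u [hu usq _]] := sqrt_1sub N hh rh.
have uu : u \is a GRing.unit.
  have : u ^+ 2 \is a GRing.unit; last by rewrite unitrX_pos.
  by have := @rh 1; rewrite usq scale1r cabs1; apply.
pose l := (- 'i) *: (u^-1 * k * u^-1).
have hl : adj l = l.
  have ci : (- 'i)^* = 'i :> R[i] by rewrite rmorphN /= conjCi opprK.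
  by rewrite /l adjZ ci !adjM adjV hu sk mulNr mulrN scalerN mulrA scaleNr.
have il : 'i *: l = u^-1 * k * u^-1.
  by rewrite /l scalerA mulrN -expr2 sqrCi opprK scale1r.
have -> : 1 - h + k = u * (1 + 'i *: l) * u.
  by rewrite il mulrDr mulr1 mulrDl -expr2 usq !mulrA divrr // mul1r mulrVK.
by rewrite unitrMl ?unitrMr // unit_1addi.
Qed.

Lemma rad_lt1_mulC x y : rad_lt1 (x * y) -> rad_lt1 (y * x).
Proof.
move=> r z z1; rewrite scalerAr; apply: unit_1subC; rewrite -scalerAl.
exact: r.
Qed.

Lemma rad_lt1Z z x : cabs z <= 1 -> rad_lt1 x -> rad_lt1 (z *: x).
Proof.
move=> z1 r w w1; rewrite scalerA; apply: r; rewrite cabsM.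
by have := cabs_ge0 w; have := cabs_ge0 z; nra.
Qed.

Lemma herm_adj_mul a : adj (adj a * a) = adj a * a.
Proof. by rewrite adjM adjK. Qed.

(** In terms of the spectral radius, [r a ^ 2 <= r (a^* a)].  Both
    [(1 + a^* ) (1 - a)] and [(1 - a) (1 + a^* )] are invertible. *)
Lemma rad_lt1_adj_mul a : rad_lt1 (adj a * a) -> rad_lt1 a.
Proof.
move=> ra z z1; set b := z *: a.
have rb : rad_lt1 (adj b * b).
  rewrite /b adjZ -scalerAl -scalerAr scalerA; apply: rad_lt1Z => //.
  by rewrite cabsM cabs_conj; have := cabs_ge0 z; nra.
have sk : adj (adj b - b) = - (adj b - b) by rewrite adjB adjK opprB.
apply: (@unit_left_right _ _ (1 + adj b) (1 + adj b)).
- have -> : (1 + adj b) * (1 - b) = 1 - adj b * b + (adj b - b).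
    by rewrite mulrDl mul1r mulrBr mulr1 addrACA [RHS]addrACA [- b - _]addrC.
  exact: unit_1sub_skew (herm_adj_mul b) rb sk.
- have -> : (1 - b) * (1 + adj b) = 1 - b * adj b + (adj b - b).
    by rewrite mulrBl mul1r mulrDr mulr1 opprD [- b - _]addrC addrACA.
  by apply: (unit_1sub_skew _ (rad_lt1_mulC rb) sk); rewrite adjM adjK.
Qed.

(** The previous lemma replaces [h k] by [k h h k], whose spectrum is that of
    [h ^+ 2 * k ^+ 2]; iterate until the powers of [h] and [k] are small. *)
Lemma rad_lt1_hermM h k : adj h = h -> adj k = k ->
  rad_lt1 h -> rad_lt1 k -> rad_lt1 (h * k).
Proof.
move=> hh hk /(rad_lt1P N)/pow_small_ge[m rm] /(rad_lt1P N)/pow_small_ge[n rn].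
have : rad_lt1 (h ^+ (2 ^ maxn m n) * k ^+ (2 ^ maxn m n)).
  apply: (rad_lt1_small (N := N)); apply: le_trans (nrmM _ _ _) _.
  have := rm _ (leq_maxl m n); have := rn _ (leq_maxr m n).
  have := nrm_ge0 N (h ^+ (2 ^ maxn m n)); have := nrm_ge0 N (k ^+ (2 ^ maxn m n)).
  by move: (N _) (N _) => p q; nra.
elim: (maxn m n) h k hh hk {rm rn} => // {m n} n IH h k hh hk.
rewrite expnS !exprM => /IH; rewrite !adjX hh hk => /(_ erefl erefl) r.
apply: rad_lt1_adj_mul; rewrite adjM hh hk -mulrA; apply: rad_lt1_mulC.
by rewrite -!mulrA mulrA -!expr2.
Qed.

(** [h >= 0]: the algebra being Hermitian, the spectrum of a Hermitian element
    is nonnegative as soon as it contains no [- t] with [0 < t]. *)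
Definition spos h := adj h = h /\
  forall t, 0 < t -> (t%:C%C)%:A + h \is a GRing.unit.

Lemma spos_unit_1add h : spos h -> 1 + h \is a GRing.unit.
Proof. by case=> _ /(_ 1 ltr01); rewrite scale1r. Qed.

Lemma sposZ s h : 0 < s -> spos h -> spos (s%:C%C *: h).
Proof.
move=> s0 [hh hp]; split=> [|t t0]; first by rewrite adjZr hh.
have sn0 := real_complex_neq0 s0.
have -> : (t%:C%C)%:A + s%:C%C *: h = s%:C%C *: (((t / s)%:C%C)%:A + h).
  by rewrite scalerDr scalerA -rmorphM /= mulrC divfK ?gt_eqF.
by rewrite scaler_unit ?unitfE // hp // divr_gt0.
Qed.

(** [t |-> t / (1 + t)] maps the positive half-line into [[0, 1[]. *)
Lemma spos_rad_lt1 h : spos h ->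
  adj ((1 + h)^-1 * h) = (1 + h)^-1 * h /\ rad_lt1 ((1 + h)^-1 * h).
Proof.
move=> ph; have u1 := spos_unit_1add ph; case: (ph) => hh hp; split.
  rewrite adjM adjV adjD adj1 hh.
  by apply/commrV/commrD => //; exact: commr1.
move=> z z1.
have -> : 1 - z *: ((1 + h)^-1 * h) = (1 + h)^-1 * (1 + (1 - z) *: h).
  rewrite scalerBl scale1r addrA mulrBr mulVr //.
  by rewrite -scalerAr.
rewrite unitrMr ?unitrV //.
have [->|w0] := eqVneq (1 - z) 0; first by rewrite scale0r addr0 unitr1.
have -> : 1 + (1 - z) *: h = (1 - z) *: ((1 - z)^-1%:A + h).
  by rewrite scalerDr scalerA divff // scale1r.
rewrite scaler_unit ?unitfE //.
have [|nr] := boolP ((1 - z)^-1 \is Num.real); last first.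
  by rewrite -unitrN opprD -scaleNr herm // realN.
rewrite realV => /complex_realP[t et]; rewrite et -fmorphV; apply: hp.
rewrite invr_gt0 lt_def; apply/andP; split.
  by apply: contra_neq w0 => t0; rewrite et t0.
have : cabs (1 - (1 - z)) <= 1 by rewrite subKr.
rewrite et -(rmorph1 (real_complex R)) -rmorphB /= cabs_real ler_norml.
by case/andP; lra.
Qed.

(** [1 + h + k = (1 + h) (1 - f g) (1 + k)], where [f = (1 + h)^-1 h] and
    [g = k (1 + k)^-1] have spectral radius below [1], hence so has [f g]. *)
Lemma sposD h k : spos h -> spos k -> spos (h + k).
Proof.
have main p q : spos p -> spos q -> 1 + p + q \is a GRing.unit.
  move=> pp pq; have [up uq] := (spos_unit_1add pp, spos_unit_1add pq).
  have [hf rf] := spos_rad_lt1 pp; have [hg rg] := spos_rad_lt1 pq.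
  have := rad_lt1_hermM hf hg rf rg; move/(_ 1); rewrite cabs1 scale1r => /(_ (lexx 1)).
  have -> : (1 + q)^-1 * q = q * (1 + q)^-1.
    by apply/commr_sym/commrV/commrD => //; exact: commr1.
  move=> u.
  have -> : 1 + p + q =
      (1 + p) * (1 - (1 + p)^-1 * p * (q * (1 + q)^-1)) * (1 + q).
    rewrite mulrBr mulr1 mulrBl !mulrA divrr // mul1r mulrVK // mulrDr mulr1.
    by rewrite mulrDl mul1r addrA addrK.
  by rewrite unitrMl // unitrMr.
move=> ph pk; case: (ph) (pk) => hh _ [hk _]; split=> [|t t0].
  by rewrite adjD hh hk.
have tn0 := real_complex_neq0 t0.
have -> : (t%:C%C)%:A + (h + k) =
    t%:C%C *: (1 + (t^-1)%:C%C *: h + (t^-1)%:C%C *: k).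
  rewrite !scalerDr !scalerA -!rmorphM /= divff ?gt_eqF // rmorph1 !scale1r.
  by rewrite addrA.
rewrite scaler_unit ?unitfE //; apply: main; apply: sposZ; rewrite ?invr_gt0 //.
Qed.

(** [x ^+ 2 + y ^+ 2 = x ^+ 2 (1 + i k) (1 - i k)] with [k = x^-1 y]. *)
Lemma unit_sum_squares x y : adj x = x -> adj y = y -> GRing.comm x y ->
  x \is a GRing.unit -> x ^+ 2 + y ^+ 2 \is a GRing.unit.
Proof.
move=> hx hy xy ux; set k := x^-1 * y.
have xk : x * k = y by rewrite /k mulrA divrr // mul1r.
have yxV : GRing.comm y x^-1 by apply/commrV/commr_sym.
have hk : adj k = k by rewrite adjM adjV hx hy.
have -> : x ^+ 2 + y ^+ 2 = x ^+ 2 * ((1 + 'i *: k) * (1 - 'i *: k)).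
  rewrite mulrDl mul1r mulrBr mulr1 -scalerAl -scalerAr scalerA -expr2 sqrCi.
  rewrite scaleN1r opprK addrA subrK mulrDr mulr1; congr (_ + _).
  rewrite -exprMn_comm ?xk //; apply: commrM => //; exact: commrV.
by rewrite unitrMl ?unitrX // unitrMr ?unit_1addi ?unit_1subi.
Qed.

Lemma spos_sqr x : adj x = x -> spos (x ^+ 2).
Proof.
move=> hx; split=> [|t t0]; first by rewrite adjX hx.
pose y : U := ((Num.sqrt t)%:C%C)%:A.
have -> : (t%:C%C)%:A = y ^+ 2.
  by rewrite /y exprZn expr1n -rmorphXn /= sqr_sqrtr // ltW.
apply: unit_sum_squares => //.
- by rewrite /y adjZr adj1.
- by apply/commr_sym/comm_scaler; exact: commr1.
- by rewrite /y scaler_unit ?unitr1 // unitfE real_complex_neq0 // sqrtr_gt0.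
Qed.

(** [b^* b + b b^*] is a sum of squares of Hermitian elements, and [b b^*] has
    the spectrum of [b^* b] up to zero: an upper bound for the spectrum of
    [b^* b] gives a lower bound. *)
Lemma unit_addr_adj_mul b s : 0 <= s ->
    (forall t, s < t -> (t%:C%C)%:A - adj b * b \is a GRing.unit) ->
  forall t, s < t -> (t%:C%C)%:A + adj b * b \is a GRing.unit.
Proof.
move=> s0 upper t st.
have sum : spos (adj b * b + b * adj b).
  (* up to sign, twice the real and imaginary parts of [b] *)
  have hx : adj (b + adj b) = b + adj b by rewrite adjD adjK addrC.
  have hy : adj ('i *: (b - adj b)) = 'i *: (b - adj b).
    by rewrite adjZ conjCi adjB adjK scaleNr -scalerN opprB.
  have -> : adj b * b + b * adj b =
      (2^-1)%:C%C *: ((b + adj b) ^+ 2 + ('i *: (b - adj b)) ^+ 2).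
    rewrite [('i *: _) ^+ 2]exprZn sqrCi scaleN1r !expr2.
    rewrite !mulrDl !mulrDr !mulrN !mulNr opprK.
    have -> : b * b + b * adj b + (adj b * b + adj b * adj b) -
        (b * b - b * adj b + (- (adj b * b) + adj b * adj b)) =
        2 *: (adj b * b + b * adj b).
      rewrite scaler_nat mulr2n !opprD !opprK.
      by rewrite !addrA [LHS](ACl ((1*5)*(4*8)*3*2*7*6)) /= !subrr !add0r.
    rewrite scalerA -(rmorph_nat (real_complex R)) -rmorphM /= mulVf ?rmorph1 ?scale1r //.
    by rewrite pnatr_eq0.
  apply: sposZ; first by rewrite invr_gt0.
  by apply: sposD; apply: spos_sqr.
have gap : spos ((s%:C%C)%:A - b * adj b).
  split=> [|u u0]; first by rewrite adjB adjZr adj1 adjM adjK.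
  have su : 0 < u + s by lra.
  rewrite addrA -scalerDl -rmorphD /=.
  have -> : ((u + s)%:C%C)%:A - b * adj b =
      (u + s)%:C%C *: (1 - b * (((u + s)^-1)%:C%C *: adj b)).
    by rewrite scalerBr -scalerAr scalerA -rmorphM divff ?gt_eqF // scale1r.
  rewrite scaler_unit ?unitfE ?real_complex_neq0 //; apply: unit_1subC; rewrite -scalerAl.
  have -> : 1 - ((u + s)^-1)%:C%C *: (adj b * b) =
      ((u + s)^-1)%:C%C *: (((u + s)%:C%C)%:A - adj b * b).
    by rewrite scalerBr scalerA -rmorphM mulVf ?gt_eqF // scale1r.
  by rewrite scaler_unit ?unitfE ?real_complex_neq0 ?invr_gt0 //; apply: upper; lra.
have [_ /(_ (t - s))] := sposD sum gap; rewrite subr_gt0 => /(_ st).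
have -> : adj b * b + b * adj b + ((s%:C%C)%:A - b * adj b) = (s%:C%C)%:A + adj b * b.
  by rewrite addrA [LHS](ACl ((2*4)*3*1)) /= subrr add0r.
by rewrite addrA -scalerDl -rmorphD /= subrK.
Qed.

Lemma herm_rad_lt1 h : adj h = h ->
    (forall t, 1 <= t -> (t%:C%C)%:A - h \is a GRing.unit) ->
    (forall t, 1 <= t -> (t%:C%C)%:A + h \is a GRing.unit) ->
  rad_lt1 h.
Proof.
move=> hh up lo z z1; have [->|z0] := eqVneq z 0.
  by rewrite scale0r subr0 unitr1.
have -> : 1 - z *: h = z *: (z^-1%:A - h).
  by rewrite scalerBr scalerA divff ?scale1r.
rewrite scaler_unit ?unitfE //.
have [|nr] := boolP (z^-1 \is Num.real); last exact: herm.
case/complex_realP=> t et; rewrite et.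
have t1 : 1 <= `|t|.
  by rewrite -cabs_real -et cabsV invf_ge1 // cabs_gt0.
have [t0|t0] := leP 0 t; first by apply: up; rewrite ger0_norm in t1.
rewrite -unitrN opprB addrC -scaleNr -rmorphN; apply: lo.
by rewrite ltr0_norm in t1.
Qed.

Lemma unit_add_ge1 a s : 1 <= s -> rad_lt1 a -> (s%:C%C)%:A + a \is a GRing.unit.
Proof.
move=> s1 ra; have s0 : 0 < s by rewrite (lt_le_trans ltr01).
have sn0 := real_complex_neq0 s0.
have -> : (s%:C%C)%:A + a = s%:C%C *: (1 - (- (s%:C%C)^-1) *: a).
  by rewrite scaleNr opprK scalerDr scalerA divff // scale1r.
rewrite scaler_unit ?unitfE //; apply: ra.
by rewrite cabsN cabsV cabs_real gtr0_norm // invf_le1.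
Qed.

(** The element [b = sqrt 2 a (1 + h)^-1], with [h = a^* a], satisfies
    [b^* b = 2 h (1 + h)^-2]. *)
Section Doubling.
Variable a : U.
Hypothesis ra : rad_lt1 (adj a * a).
Local Notation h := (adj a * a).
Local Notation q := (2 *: ((1 + h)^-1 * h * (1 + h)^-1)).

Let hh : adj h = h := herm_adj_mul a.

Let u1 : 1 + h \is a GRing.unit.
Proof.
by have := @ra (-1); rewrite cabsN cabs1 scaleN1r opprK => /(_ (lexx 1)).
Qed.

Lemma doubling_adj_mul : exists b, adj b * b = q.
Proof.
exists ((Num.sqrt 2)%:C%C *: (a * (1 + h)^-1)).
rewrite adjZr -scalerAl -scalerAr scalerA -rmorphM /= -expr2 sqr_sqrtr //.
rewrite rmorph_nat; congr (_ *: _).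
by rewrite adjM adjV adjD adj1 hh !mulrA.
Qed.

Lemma unit_add_doubling z : (z%:A + q \is a GRing.unit) =
  (z *: (1 + h) ^+ 2 + 2 *: h \is a GRing.unit).
Proof.
have -> : z *: (1 + h) ^+ 2 + 2 *: h = (1 + h) * (z%:A + q) * (1 + h).
  move: (1 + h) u1 => g ug.
  rewrite mulrDr mulrDl -!scalerAr -!scalerAl mulr1 -expr2.
  by rewrite !mulrA divrr // mul1r mulrVK.
by rewrite unitrMl // unitrMr.
Qed.

(** The reason is that [2 x / (1 + x) ^ 2 <= 1 / 2] for real [x]; in terms of
    [h], [2 (t (1 + h) ^ 2 - 2 h) = (2 t - 1) (1 + h) ^ 2 + (1 - h) ^ 2] is a sum
    of squares. *)
Lemma unit_sub_doubling t : 1 / 2 < t -> (t%:C%C)%:A - q \is a GRing.unit.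
Proof.
move=> t2; have -> : (t%:C%C)%:A - q = - ((- t%:C%C)%:A + q).
  by rewrite opprD scaleNr opprK.
rewrite unitrN unit_add_doubling.
pose r := Num.sqrt (2 * t - 1); have r0 : 0 < r by rewrite sqrtr_gt0; lra.
have rr : r%:C%C ^+ 2 = 2 * t%:C%C - 1.
  by rewrite -rmorphXn /= sqr_sqrtr ?rmorphB ?rmorphM ?rmorph1 ?rmorph_nat //; lra.
have := @unit_sum_squares (r%:C%C *: (1 + h)) (1 - h).
rewrite adjZr adjD adjB adj1 hh exprZn rr => /(_ erefl erefl).
have c : GRing.comm (r%:C%C *: (1 + h)) (1 - h).
  apply/commr_sym/comm_scaler/commrD; first exact: commr1.
  by apply/commr_sym/commrB => //; exact: commr1.
have rn0 := real_complex_neq0 r0.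
rewrite scaler_unit ?unitfE // => /(_ c u1).
move: (t%:C%C) => z; move: h => g.
have -> : (2 * z - 1) *: (1 + g) ^+ 2 + (1 - g) ^+ 2 =
    (-2) *: (- z *: (1 + g) ^+ 2 + 2 *: g).
  (* a polynomial identity, evaluated at [g] *)
  have e : (2 * z - 1)%:P * (1 + 'X) ^+ 2 + (1 - 'X) ^+ 2 =
      (- 2)%:P * ((- z)%:P * (1 + 'X) ^+ 2 + 2%:P * 'X) :> {poly R[i]} by ring.
  move: (2 : R[i]) (- z) (- 2) (2 * z - 1) e => k4 k3 k2 k1 e.
  have := congr1 (horner_alg g) e.
  rewrite !(rmorphD, rmorphN, rmorphM, rmorphXn, rmorph1) /=.
  by rewrite !horner_algX !horner_algC !mulr_algl.
rewrite scaler_unit // unitfE oppr_eq0 pnatr_eq0 //.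
Qed.

(** [x |-> 2 x / (1 + x) ^ 2] sends [- s] to [- 2 s / (1 - s) ^ 2], so that
    [s + h] divides [2 s / (1 - s) ^ 2 + q] up to invertible factors:
    [s (1 + h) ^ 2 + (1 - s) ^ 2 h = (s + h) (1 + s h)]. *)
Lemma unit_add_of_doubling s : 0 < s -> s < 1 ->
  ((2 * s / (1 - s) ^+ 2)%:C%C)%:A + q \is a GRing.unit ->
  (s%:C%C)%:A + h \is a GRing.unit.
Proof.
move=> s0 s1; rewrite unit_add_doubling.
have d0 : 1 - s != 0 by rewrite subr_eq0 gt_eqF.
have dn0 : ((1 - s) ^+ 2 / 2)%:C%C != 0 :> R[i].
  rewrite -cabs_gt0 cabs_real normr_gt0 mulf_neq0 ?expf_neq0 //.
  by rewrite invr_eq0 pnatr_eq0.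
rewrite -(scaler_unit (k := ((1 - s) ^+ 2 / 2)%:C%C)) ?unitfE //.
rewrite scalerDr !scalerA -!rmorphM /=.
have -> : (1 - s) ^+ 2 / 2 * (2 * s / (1 - s) ^+ 2) = s by field.
have -> : ((1 - s) ^+ 2 / 2)%:C%C * 2 = (1 - s%:C%C) ^+ 2 :> R[i].
  rewrite -(rmorph_nat (real_complex R)) -rmorphM /= divfK ?pnatr_eq0 //.
  by rewrite rmorphXn rmorphB rmorph1.
move: (s%:C%C) (h) => z g.
have -> : z *: (1 + g) ^+ 2 + (1 - z) ^+ 2 *: g = (z%:A + g) * (1 + z *: g).
  have e : z%:P * (1 + 'X) ^+ 2 + ((1 - z) ^+ 2)%:P * 'X =
      (z%:P * 1 + 'X) * (1 + z%:P * 'X) :> {poly R[i]} by ring.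
  move: ((1 - z) ^+ 2) e => k e.
  have := congr1 (horner_alg g) e.
  rewrite !(rmorphD, rmorphN, rmorphM, rmorphXn, rmorph1) /=.
  by rewrite !horner_algX !horner_algC !mulr_algl.
rewrite unitrM_comm; first by case/andP.
apply: commrD; first exact: commr1.
apply: comm_scaler; apply: commr_sym; apply: commrD => //.
by apply: comm_scaler; exact: commr1.
Qed.

End Doubling.

(** A point [- s] of the spectrum of [a^* a] leads to a point of at least twice
    its modulus in the spectrum of [b^* b], which again has spectral radius
    below [1]; after [n] steps the modulus is at least [1]. *)
Lemma unit_add_adj_mul_rad_lt1 n a s : 0 < s -> 1 <= 2 ^+ n * s ->
  rad_lt1 (adj a * a) -> (s%:C%C)%:A + adj a * a \is a GRing.unit.
Proof.
elim: n a s => [|n IH] a s s0 ns ra; have [s1|s1] := leP 1 s.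
- exact: unit_add_ge1.
- by move: ns s1; rewrite expr0 mul1r => /le_lt_trans h /h; rewrite ltxx.
- exact: unit_add_ge1.
apply: unit_add_of_doubling => //.
have [b eb] := doubling_adj_mul a; rewrite -eb.
have up t : 1 / 2 < t -> (t%:C%C)%:A - adj b * b \is a GRing.unit.
  by rewrite eb; exact: unit_sub_doubling.
have half0 : 0 <= 1 / 2 :> R by rewrite divr_ge0.
have lo := unit_addr_adj_mul half0 up.
have rb : rad_lt1 (adj b * b).
  by apply: herm_rad_lt1 => [|t t1|t t1]; [exact: herm_adj_mul | apply: up | apply: lo]; lra.
have le2 : 2 * s <= 2 * s / (1 - s) ^+ 2.
  rewrite ler_pdivlMr ?exprn_gt0 ?subr_gt0 //; nra.
apply: IH => //; first by lra.
apply: le_trans ns _; rewrite exprSr -mulrA ler_pM2l ?exprn_gt0 //.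
Qed.

Lemma unit_add_adj_mul a s : 0 < s -> (s%:C%C)%:A + adj a * a \is a GRing.unit.
Proof.
move=> s0; pose e := (2 * (N (adj a * a) + 1))^-1.
(* rescaled so that [b^* b] has norm at most [1 / 2] *)
have k0 : 0 < 2 * (N (adj a * a) + 1) by have := nrm_ge0 N (adj a * a); lra.
have e0 : 0 < e by rewrite invr_gt0.
pose b := (Num.sqrt e)%:C%C *: a.
have eb : adj b * b = e%:C%C *: (adj a * a).
  by rewrite /b adjZr -scalerAl -scalerAr scalerA -rmorphM /= -expr2 sqr_sqrtr // ltW.
have rb : rad_lt1 (adj b * b).
  apply: (rad_lt1_small (N := N)); rewrite eb nrmZ cabs_real gtr0_norm //.
  rewrite mulrC ler_pdivrMr //; have := nrm_ge0 N (adj a * a); lra.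
have es0 : 0 < e * s by rewrite mulr_gt0.
have := archi_boundP (ltW es0 : 0 <= e * s).
have inv0 : 0 <= (e * s)^-1 by rewrite invr_ge0 ltW.
move=> _; have ub := archi_boundP inv0; set n := Num.bound _ in ub.
have ns : 1 <= 2 ^+ n * (e * s).
  rewrite -ler_pdivrMr // mul1r (le_trans (ltW ub)) // -natrX ler_nat.
  by rewrite ltnW // ltn_expl.
have := unit_add_adj_mul_rad_lt1 es0 ns rb; rewrite eb.
have -> : ((e * s)%:C%C)%:A + e%:C%C *: (adj a * a) =
    e%:C%C *: ((s%:C%C)%:A + adj a * a) by rewrite scalerDr scalerA -rmorphM.
by rewrite scaler_unit // unitfE real_complex_neq0.
Qed.

Lemma unit_sub_adj_mul a z : ~~ (0 <= z) -> z%:A - adj a * a \is a GRing.unit.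
Proof.
have [/complex_realP[t ->]|nr _] := boolP (z \is Num.real); last first.
  by apply: herm => //; exact: herm_adj_mul.
rewrite ler0c -ltNge => t0; rewrite -unitrN opprB addrC -scaleNr -rmorphN.
by apply: unit_add_adj_mul; rewrite oppr_gt0.
Qed.

End Hermitian.

(** * Unitisations as Banach star-algebras *)

(** Inverses are chosen classically: the theory of units then applies, and its
    units are the invertible elements. *)
Section UnitalOverRing.
Variables (K : comNzRingType) (A : nonUnitalAlgType K) (B : unital_over A).

Definition uo_ring : Type := uo_alg B.

HB.instance Definition _ := GRing.Lmodule.on uo_ring.

Let one : uo_ring := uo_unity B.
Let mul (x y : uo_ring) : uo_ring := amul (x : B) y.

Let mulA : associative mul. Proof. exact: amulA. Qed.
Let mul1l : left_id one mul.
Proof. by move=> x; case: (uo_unityP B) => _ /(_ x)[]. Qed.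
Let mul1r : right_id one mul.
Proof. by move=> x; case: (uo_unityP B) => _ /(_ x)[]. Qed.
Let mulDl : left_distributive mul +%R. Proof. exact: amulDl. Qed.
Let mulDr : right_distributive mul +%R. Proof. exact: amulDr. Qed.
Let one_neq0 : one != 0.
Proof. by apply/eqP; case: (uo_unityP B). Qed.

HB.instance Definition _ := GRing.Zmodule_isNzRing.Build uo_ring
  mulA mul1l mul1r mulDl mulDr one_neq0.

Let scaleAl (k : K) (x y : uo_ring) : k *: (x * y) = k *: x * y.
Proof. by rewrite /GRing.mul /= /mul amulZl. Qed.
HB.instance Definition _ := GRing.Lmodule_isLalgebra.Build K uo_ring scaleAl.

Let scaleAr (k : K) (x y : uo_ring) : k *: (x * y) = x * (k *: y).
Proof. by rewrite /GRing.mul /= /mul amulZr. Qed.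
HB.instance Definition _ := GRing.Lalgebra_isAlgebra.Build K uo_ring scaleAr.

Let unit : pred uo_ring := fun x => `[< invertible (x : B) >].
Let inv (x : uo_ring) : uo_ring :=
  if pselect (invertible (x : B)) is left h then projT1 (cid h) else x.

Let mulVx : {in unit, left_inverse 1 inv *%R}.
Proof.
move=> x /asboolP ix; rewrite /inv; case: pselect => // h.
by case: (projT2 (cid h)).
Qed.
Let mulxV : {in unit, right_inverse 1 inv *%R}.
Proof.
move=> x /asboolP ix; rewrite /inv; case: pselect => // h.
by case: (projT2 (cid h)).
Qed.
Let unitP (x y : uo_ring) : y * x = 1 /\ x * y = 1 -> unit x.
Proof. by case=> yx xy; apply/asboolP; exists y. Qed.
Let inv_out : {in [predC unit], inv =1 id}.
Proof.
move=> x; rewrite inE => /asboolP nx.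
by rewrite /inv; case: pselect.
Qed.

HB.instance Definition _ := GRing.NzRing_hasMulInverse.Build uo_ring
  mulVx mulxV unitP inv_out.

Lemma uo_ring_unit (x : uo_ring) : x \is a GRing.unit <-> invertible (x : B).
Proof. by split=> /asboolP. Qed.

End UnitalOverRing.

(** * Completeness of the norms on unitisations *)

Section Completeness.
Variable R : realType.

Definition cauchy_complete (V : zmodType) (n : V -> R) := forall u : nat -> V,
    (forall e, 0 < e -> exists M, forall k, (M <= k)%N -> n (u k - u M) <= e) ->
  exists l, forall e, 0 < e -> exists M, forall k, (M <= k)%N -> n (u k - l) <= e.

(** The increments after rank [M] add up to at most [2 c / 2 ^ M]. *)
Lemma geometric_cauchy (V : zmodType) (n : V -> R) (u : nat -> V) (c : R) :
    n 0 = 0 -> (forall x, 0 <= n x) -> (forall x y, n (x + y) <= n x + n y) ->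
    (forall k, n (u k.+1 - u k) <= c * 2^-1 ^+ k) ->
  forall e, 0 < e -> exists M, forall k, (M <= k)%N -> n (u k - u M) <= e.
Proof.
move=> n0 n_ge0 tri step e e0.
have tail M k : n (u (k + M)%N - u M) <= 2 * c * (2^-1 ^+ M - 2^-1 ^+ (k + M)).
  elim: k => [|k IH]; first by rewrite !subrr mulr0 n0.
  have := tri (u (k.+1 + M)%N - u (k + M)%N) (u (k + M)%N - u M).
  rewrite subrKA => h; have := step (k + M)%N; rewrite -addSn => h'.
  have -> : 2^-1 ^+ (k.+1 + M) = 2^-1 ^+ (k + M) / 2 :> R by rewrite addSn exprSr.
  by move: IH h h'; move: (2^-1 ^+ (k + M)) (2^-1 ^+ M) => p q; lra.
have := archi_boundP (normr_ge0 (2 * c / e)); set M := Num.bound _ => hM.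
exists M => k /subnK <-; apply: le_trans (tail _ _) _.
have p0 m : 0 < 2^-1 ^+ m :> R by rewrite exprn_gt0 ?invr_gt0.
have c0 : 0 <= 2 * c.
  by have := le_trans (n_ge0 _) (step 0%N); rewrite expr0 mulr1; lra.
apply: (@le_trans _ _ (2 * c * 2^-1 ^+ M)).
  by rewrite ler_wpM2l // lerBlDr lerDl ltW.
rewrite exprVn ler_pdivrMr ?exprn_gt0 // -ler_pdivrMl // mulrC.
apply: le_trans (ler_norm _) _; rewrite ltW // (lt_le_trans hM) //.
by rewrite -natrX ler_nat ltnW // ltn_expl.
Qed.

Lemma complete_lim (K : numFieldType) (V : completeNormedModType K) (u : nat -> V) :
    (forall e, 0 < e -> exists M, forall k, (M <= k)%N -> `|u k - u M| <= e) ->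
  exists l, forall e, 0 < e -> exists M, forall k, (M <= k)%N -> `|u k - l| <= e.
Proof.
move=> cu; have /cauchy_cvg cvgu : cauchy (u @ \oo)%classic.
  apply: cauchy_exP => e e0; have [M uM] := cu (e / 2) (divr_gt0 e0 (ltr0n _ 2)).
  exists (u M); exists M => // k /= Mk; rewrite -ball_normE /= distrC.
  by apply: le_lt_trans (uM k Mk) _; rewrite ltr_pdivrMr // ltr_pMr // ltr1n.
exists (lim (u @ \oo)%classic) => e e0.
move/cvgrPdist_le: cvgu => /(_ e e0)[M _ uM]; exists M => k Mk.
by rewrite distrC; exact: uM.
Qed.

Lemma cabs_le_ReIm (z : R[i]) : cabs z <= `|complex.Re z| + `|complex.Im z|.
Proof.
rewrite -(ler_pXn2r (_ : 0 < 2)%N) ?nnegrE ?cabs_ge0 ?addr_ge0 // cabs_ReIm.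
rewrite sqrrD !real_normK ?num_real // -addrA lerD2l addrC lerDl.
by rewrite mulrn_wge0 // mulr_ge0.
Qed.

Lemma cabs_complete : cauchy_complete (@cabs R).
Proof.
move=> u cu.
have part (p : R[i] -> R) : (forall z w, p (z - w) = p z - p w) ->
    (forall z, `|p z| <= cabs z) -> exists l, forall e, 0 < e ->
    exists M, forall k, (M <= k)%N -> `|p (u k) - l| <= e.
  move=> pB p_le; apply: (@complete_lim R R (p \o u)) => e e0.
  have [M uM] := cu e e0; exists M => k Mk.
  by rewrite -pB (le_trans (p_le _)) // uM.
have [||a ha] := part (@complex.Re R).
- by move=> [? ?] [? ?].
- by move=> z; rewrite -lecR -cabsE normc_ge_Re.
have [||b hb] := part (@complex.Im R).
- by move=> [? ?] [? ?].
- move=> z; rewrite -(ler_pXn2r (_ : 0 < 2)%N) ?nnegrE ?cabs_ge0 //.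
  by rewrite cabs_ReIm real_normK ?num_real // lerDr sqr_ge0.
exists (a +i* b)%C => e e0; have e2 : 0 < e / 2 by rewrite divr_gt0.
have [M hM] := ha _ e2; have [M' hM'] := hb _ e2; exists (maxn M M') => k.
rewrite geq_max => /andP[/hM h1 /hM' h2].
apply: le_trans (cabs_le_ReIm _) _.
by move: h1 h2; case: (u k) => x y /=; lra.
Qed.

Section ModulusOfNorm.
Variable V : completeNormedModType R[i].
Implicit Types x y : V.

(** The norm of [V] takes its values in [R[i]]. *)
Definition rnorm x : R := complex.Re `|x|.

Lemma rnormE x : `|x| = (rnorm x)%:C%C.
Proof. by rewrite /rnorm RRe_real // normr_real. Qed.

Lemma rnorm_ge0 x : 0 <= rnorm x.
Proof. by rewrite -ler0c -rnormE. Qed.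

Lemma rnorm0 : rnorm 0 = 0.
Proof. by rewrite /rnorm normr0. Qed.

Lemma rnorm_eq0 x : rnorm x = 0 -> x = 0.
Proof. by move=> x0; apply/eqP; rewrite -normr_eq0 rnormE x0. Qed.

Lemma rnormD x y : rnorm (x + y) <= rnorm x + rnorm y.
Proof. by rewrite -lecR rmorphD /= -!rnormE ler_normD. Qed.

Lemma rnormZ k x : rnorm (k *: x) = cabs k * rnorm x.
Proof. by apply: complexI; rewrite rmorphM /= -!rnormE -cabsE normrZ. Qed.

Lemma rnorm_complete : cauchy_complete rnorm.
Proof.
move=> u cu; have [|l ul] := @complete_lim _ _ u.
  move=> e e0; have eR : e = (complex.Re e)%:C%C by rewrite RRe_real // gtr0_real.
  rewrite eR; have [|M uM] := cu (complex.Re e); first by rewrite -ltcR -eR.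
  by exists M => k Mk; rewrite rnormE lecR uM.
exists l => e e0; have [|M uM] := ul (e%:C%C); first by rewrite ltcR.
by exists M => k Mk; rewrite -lecR -rnormE uM.
Qed.

End ModulusOfNorm.

End Completeness.

Section UnitalStar.
Variables (R : realType) (A : banachStarAlgType R[i]) (e : A) (he : is_unity e).
Local Notation B := (uo_ring (UnitalOver he id)).

Let rnorm_unital_complete (u : nat -> B) (c : R) :
    (forall k, rnorm (u k.+1 - u k : A) <= c * 2^-1 ^+ k) -> exists l : B,
  forall d, 0 < d -> exists M, forall k, (M <= k)%N -> rnorm (u k - l : A) <= d.
Proof.
move=> step; apply: (@rnorm_complete R A).
exact: geometric_cauchy (@rnorm0 _ A) (@rnorm_ge0 _ A) (@rnormD _ A) step.
Qed.

Lemma rnorm_amul (x y : A) : rnorm (x ** y) <= rnorm x * rnorm y.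
Proof. by rewrite -lecR rmorphM /= -!rnormE norm_amul_le. Qed.

Definition unital_norm : banach_norm B :=
  @BanachNorm R B (@rnorm R A) (@rnormD R A) rnorm_amul (@rnormZ R A)
    (@rnorm_eq0 R A) rnorm_unital_complete.

Definition unital_star : involution B :=
  @Involution R B (@star _ A) (@starD _ A) (@starZ _ A) (@starK _ A) (@starM _ A).

End UnitalStar.

Section AdjoinStar.
Variables (R : realType) (A : banachStarAlgType R[i]).
Local Notation B := (uo_ring (UnitalOver (adjoin_unityP A) (fun a => (0, a)))).
Implicit Types x y : B.

Definition adjoin_nrm x : R := cabs x.1 + rnorm (x.2 : A).

Let nrmD x y : adjoin_nrm (x + y) <= adjoin_nrm x + adjoin_nrm y.
Proof. by rewrite /adjoin_nrm addrACA lerD ?cabsD ?rnormD. Qed.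

Let nrmM x y : adjoin_nrm (x * y) <= adjoin_nrm x * adjoin_nrm y.
Proof.
case: x y => [k a] [l b]; rewrite /adjoin_nrm /= cabsM.
have h : rnorm (k *: b + l *: a + a ** b) <=
    cabs k * rnorm b + cabs l * rnorm a + rnorm a * rnorm b.
  apply: le_trans (rnormD _ _) _; apply: lerD (rnorm_amul _ _).
  by rewrite -!rnormZ rnormD.
by move: h; move: (rnorm _) (rnorm _) (rnorm _) => r s t; lra.
Qed.

Let nrmZ k x : adjoin_nrm (k *: x) = cabs k * adjoin_nrm x.
Proof. by rewrite /adjoin_nrm /= cabsM rnormZ mulrDr. Qed.

Let nrm_ge0 x : 0 <= adjoin_nrm x.
Proof. by rewrite addr_ge0 ?cabs_ge0 ?rnorm_ge0. Qed.

Let nrm0 : adjoin_nrm 0 = 0.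
Proof. by rewrite /adjoin_nrm /= cabs0 rnorm0 addr0. Qed.

Let nrm_eq0 x : adjoin_nrm x = 0 -> x = 0.
Proof.
case: x => [k a] /eqP; rewrite /adjoin_nrm /= paddr_eq0 ?cabs_ge0 ?rnorm_ge0 //.
by case/andP; rewrite cabs_eq0 => /eqP -> /eqP/rnorm_eq0 ->.
Qed.

Let complete (u : nat -> B) (c : R) :
    (forall k, adjoin_nrm (u k.+1 - u k) <= c * 2^-1 ^+ k) -> exists l : B,
  forall d, 0 < d -> exists M, forall k, (M <= k)%N -> adjoin_nrm (u k - l) <= d.
Proof.
move/(geometric_cauchy nrm0 nrm_ge0 nrmD) => cu.
have [|k hk] := @cabs_complete R (fun n => (u n).1).
  move=> d d0; have [M hM] := cu d d0; exists M => n /hM; apply: le_trans.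
  by rewrite /adjoin_nrm lerDl rnorm_ge0.
have [|a ha] := @rnorm_complete R A (fun n => (u n).2).
  move=> d d0; have [M hM] := cu d d0; exists M => n /hM; apply: le_trans.
  by rewrite /adjoin_nrm lerDr cabs_ge0.
exists (k, a) => d d0; have d2 : 0 < d / 2 by rewrite divr_gt0.
have [M hM] := hk _ d2; have [M' hM'] := ha _ d2; exists (maxn M M') => n.
rewrite geq_max => /andP[/hM h1 /hM' h2]; rewrite /adjoin_nrm /=.
by rewrite [d]splitr lerD.
Qed.

Definition adjoin_norm : banach_norm B :=
  BanachNorm nrmD nrmM nrmZ nrm_eq0 complete.

Definition adjoin_adj x : B := ((x.1 : R[i])^*, star (x.2 : A)).

Let adjD x y : adjoin_adj (x + y) = adjoin_adj x + adjoin_adj y.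
Proof. by congr pair; rewrite /= ?starD ?rmorphD. Qed.

Let adjZ k x : adjoin_adj (k *: x) = k^* *: adjoin_adj x.
Proof. by congr pair; rewrite /= ?starZ ?rmorphM. Qed.

Let adjK x : adjoin_adj (adjoin_adj x) = x.
Proof. by case: x => k a; congr pair; rewrite /= ?starK ?conjCK. Qed.

Let adjM x y : adjoin_adj (x * y) = adjoin_adj y * adjoin_adj x.
Proof.
congr pair => /=; first by rewrite mulrC rmorphM.
by rewrite !starD !starZ starM [X in X + _]addrC.
Qed.

Definition adjoin_star : involution B := Involution adjD adjZ adjK adjM.

End AdjoinStar.

Lemma unitisation_inM (K : comNzRingType) (A : nonUnitalAlgType K) (a b : A) :
  uo_in (unitisation A) (a ** b) = uo_in (unitisation A) a ** uo_in (unitisation A) b.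
Proof.
rewrite /unitisation; case: pselect => //= _.
by congr pair => /=; rewrite ?mul0r // !scale0r !add0r.
Qed.

(** [z ^+ 2 - a ^+ 2 = (z - a) (z + a)], a product of commuting factors. *)
Lemma sp_sqr (K : comNzRingType) (A : nonUnitalAlgType K) (a : A) (z : K) :
  sp a z -> sp (a ** a) (z ^+ 2).
Proof.
rewrite /sp /= unitisation_inM; apply: contra_not.
set x : uo_ring (unitisation A) := uo_in _ a.
have -> : z ^+ 2 *: uo_unity (unitisation A) - (x : unitisation A) ** x =
    (z%:A - x) * (z%:A + x) :> uo_ring (unitisation A).
  rewrite mulrDr !mulrBl -!scalerAl !mul1r -scalerAr mulr1 scalerA -expr2.
  by rewrite addrA subrK.
move=> /uo_ring_unit; rewrite unitrM_comm.
  by case/andP => /uo_ring_unit.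
have c : GRing.comm x (z%:A) by apply: comm_scaler; exact: commr1.
by apply: commrD; apply: commr_sym; apply: commrB.
Qed.

(** If the unity is adjoined, the larger algebra is Hermitian too: a Hermitian
    [(k, x)] has [k] real, and its spectrum is that of [x] shifted by [k]. *)
Lemma sp_adj_mul_ge0 (R : realType) (A : banachStarAlgType R[i]) (a : A) (z : R[i]) :
  hermitian_alg A -> sp (star a ** a) z -> 0 <= z.
Proof.
rewrite /hermitian_alg /sp /unitisation; case: pselect => [h|nounit] herm;
  apply: contra_notT => z0; apply/uo_ring_unit.
- apply: (unit_sub_adj_mul (unital_norm (projT2 (cid h)))
    (adj := unital_star (projT2 (cid h)))) z0 => x w hx nr.
  apply/uo_ring_unit; apply: contrapT => /(herm x (esym hx)).
  by apply/negP.
- have -> : z *: uo_unity (UnitalOver (adjoin_unityP A) (fun a => (0, a)))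
      - (0, star a ** a) = z%:A - adjoin_star A (0, a) * (0, a).
    congr (_ - _); congr pair; rewrite /= ?mulr0 // conjC0 !scale0r !add0r //.
  apply: (unit_sub_adj_mul (adjoin_norm A)) z0 => -[k x] w [hk hx] nr.
  apply/uo_ring_unit; apply: contrapT => ni.
  have kr : k \is Num.real by rewrite CrealE hk.
  have : w - k \is Num.real.
    apply: (herm x (esym hx)) => /= inv_wk; apply: ni; move: inv_wk.
    congr invertible; congr pair.
      change ((w - k) * 1 - 0 = w * 1 - k); by rewrite !mulr1 subr0.
    by rewrite /= !scaler0.
  by move=> /realD /(_ kr); rewrite subrK; exact/negP.
Qed.

Theorem theorem17p14 (R : realType) (A : banachStarAlgType R[i]) :
  hermitian_alg A <-> (forall a : A, star_nonneg (star a ** a)).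
Proof.
split=> [herm a|pos a ha z spz].
  split; first by rewrite /hermitian_elt starM starK.
  by move=> z; exact: sp_adj_mul_ge0.
have [_ /(_ (z ^+ 2))] := pos a.
rewrite -ha => /(_ (sp_sqr spz)) /= z2.
by rewrite realEsqr.
Qed.
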